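(* Let $k$ be a positive integer and consider the $k$-th order system of two rational difference equations $$x_n=\frac{\alpha+\sum^{k}_{i=1}\beta_{i}x_{n-i} + \sum^{k}_{i=1}\gamma_{i}y_{n-i}}{A+\sum^{k}_{j=1}B_{j}x_{n-j} + \sum^{k}_{j=1}C_{j}y_{n-j}},\qquad y_n=\frac{p+\sum^{k}_{i=1}\delta_{i}x_{n-i} + \sum^{k}_{i=1}\epsilon_{i}y_{n-i}}{q+\sum^{k}_{j=1}D_{j}x_{n-j} + \sum^{k}_{j=1}E_{j}y_{n-j}},\qquad n\in\mathbb{N},$$ with non-negative real parameters and non-negative initial conditions. Assume that there exist $M_1>0$ and $M_2\ge 0$ such that every solution satisfies $y_n\le M_1x_n+M_2$ for all $n\in\mathbb{N}$. Assume further that $A>0$, $q>0$, $I_\delta\subseteq I_D$; that there exists a positive integer $\eta_1$ such that for every sequence $\{c_m\}_{m=1}^\infty$ with $c_m\in I_\epsilon$ for all $m\ge 1$ there exist positive integers $N_1,N_2\le\eta_1$ such that $\sum_{m=N_1}^{N_2}c_m\in I_D\cup I_E$; and that there exists a positive integer $\eta_2$ such that for every sequence $\{d_m\}_{m=1}^\infty$ with $d_m\in I_\beta$ for all $m\ge 1$ there exist positive integers $N_3,N_4\le\eta_2$ such that $\sum_{m=N_3}^{N_4}d_m\in I_B$. Then there exist $M>0$ and $N\in\mathbb{N}$ such that every solution (from any non-negative initial conditions) satisfies $x_n\le M$ and $y_n\le M$ for all $n>N$.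
   Context: $\mathbb{N}=\{1,2,\dots\}$. Initial conditions are $x_{1-k},\dots,x_0,y_{1-k},\dots,y_0\ge 0$; a solution is a pair of sequences generated by the system from non-negative initial conditions for which all denominators are positive for every $n\in\mathbb{N}$. Index sets in $\{1,\dots,k\}$: $I_\beta=\{i:\beta_i>0\}$, $I_\delta=\{i:\delta_i>0\}$, $I_\epsilon=\{i:\epsilon_i>0\}$, $I_B=\{j:B_j>0\}$, $I_D=\{j:D_j>0\}$, $I_E=\{j:E_j>0\}$. A sum whose lower limit exceeds its upper limit is empty and equals $0$. *)

(* Defs.v *)
From HB Require Import structures.
From mathcomp Require Import all_boot all_order all_algebra.
From mathcomp Require Import reals.

Set Implicit Arguments.
Unset Strict Implicit.
Unset Printing Implicit Defensive.

Import Order.TTheory GRing.Theory Num.Theory.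

Local Open Scope ring_scope.

(* Coefficient families are functions on [nat] of which only the values at
   1, ..., k are ever used.  Sequences are functions on [int] of which only the
   values at indices >= 1 - k are ever used. *)

Definition affine_lag (R : realType) (k : nat) (a : R) (b c : nat -> R)
    (x y : int -> R) (n : nat) : R :=
  a + \sum_(1 <= i < k.+1) b i * x (n%:Z - i%:Z)
    + \sum_(1 <= i < k.+1) c i * y (n%:Z - i%:Z).

Definition nonneg_coefs (R : realType) (k : nat) (b : nat -> R) : Prop :=
  forall i : nat, (1 <= i <= k)%N -> 0 <= b i.

Definition pos_index (R : realType) (k : nat) (b : nat -> R) : pred nat :=
  [pred i : nat | (1 <= i <= k)%N && (0 < b i)].

(* Positivity of the denominators is part of the definition because division
   by 0 is total in a [realType]. *)
Definition is_solution (R : realType) (k : nat)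
    (alpha : R) (beta gamma : nat -> R) (A : R) (B C : nat -> R)
    (p : R) (delta epsilon : nat -> R) (q : R) (D E : nat -> R)
    (x y : int -> R) : Prop :=
  (forall m : int, 1 - k%:Z <= m <= 0 -> 0 <= x m /\ 0 <= y m) /\
  (forall n : nat, (1 <= n)%N ->
    [/\ 0 < affine_lag k A B C x y n,
        0 < affine_lag k q D E x y n,
        x n%:Z = affine_lag k alpha beta gamma x y n / affine_lag k A B C x y n
      & y n%:Z = affine_lag k p delta epsilon x y n / affine_lag k q D E x y n]).

(* Every sequence (c_m)_{m >= 1} in [I] has, within its first [eta] terms, a
   block of consecutive terms whose sum lies in [J]; [c 0] is unconstrained. *)
Definition block_sums_hit (I J : pred nat) (eta : nat) : Prop :=
  forall c : nat -> nat, (forall m : nat, (1 <= m)%N -> c m \in I) ->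
  exists N1 N2 : nat,
    [/\ (1 <= N1 <= eta)%N, (1 <= N2 <= eta)%N
      & (\sum_(N1 <= m < N2.+1) c m)%N \in J].

(* Main.v *)
(** Both halves are one argument, applied to y and then to x: suppose
    z_n <= K0 + (sum_i w_i z_(n-i)) / den_n with den_n >= a > 0, and
    z_(n-s) <= K1 den_n for every s in J.  Expanding the right-hand side
    repeatedly yields terms indexed by chains of lags c_1, c_2, ..., each with
    coefficient a product of factors w_c / den.  As soon as a block of
    consecutive lags of a chain has sum s in J, the denominator at the start of
    the block absorbs z at its end, so the term is bounded; by hypothesis this
    happens within eta steps on every chain.  For y, the terms delta_i x_(n-i)
    are absorbed because D_i > 0, and y <= M1 x + M2 turns D_s x_(n-s) in the
    denominator into a bound for y_(n-s). *)
Require Import Defs.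
From HB Require Import structures.
From mathcomp Require Import all_boot all_order all_algebra.
From mathcomp Require Import boolp reals.
From mathcomp Require Import zify ring lra.

Set Implicit Arguments.
Unset Strict Implicit.
Unset Printing Implicit Defensive.

Import Order.TTheory GRing.Theory Num.Theory.

Local Open Scope ring_scope.

(** Links [block_sums_hit] to lists: with lags stored latest first, index [size l - m] reads the
    [m]-th lag chosen, so a block of consecutive lags is a segment of [l]. At [m = 0] the index is
    past the end and the default 0 is read. *)
Lemma big_nat_nth_sumn (l : seq nat) (N1 N2 : nat) :
  (N2 <= size l)%N ->
  (\sum_(N1 <= m < N2.+1) nth 0 l (size l - m) =
    sumn (take (N2.+1 - N1) (drop (size l - N2) l)))%N.
Proof.
elim: N2 => [|N2 IH] ltN.
  rewrite subn0 drop_size; case: N1 => [|N1]; last by rewrite big_geq.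
  by rewrite big_nat1 subn0 nth_default.
have [ltN12|leN12] := ltnP N2.+1 N1.
  by rewrite big_geq // (eqP ltN12) take0.
rewrite big_nat_recr //= IH ?(ltnW ltN) //.
rewrite [in RHS](drop_nth 0%N); last by lia.
have -> : ((size l - N2.+1).+1 = size l - N2)%N by lia.
by rewrite (subSn leN12) /= addnC.
Qed.

(** [M] and [N] are chosen before [z] and [den], hence serve all solutions at once. Since 0 is not
    in [J], an empty block is never a hit. *)
Lemma block_hit_bound (R : realType) (k eta n0 : nat) (w : nat -> R)
    (J : pred nat) (a K0 K1 : R) :
  nonneg_coefs k w -> 0 < a -> 0 <= K0 -> 0 <= K1 -> 0%N \notin J ->
  (0 < eta)%N -> block_sums_hit (pos_index k w) J eta ->
  exists (M : R) (N : nat), 0 <= M /\ forall z den : nat -> R,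
    (forall n, (n0 < n)%N -> [/\ a <= den n,
       z n <= K0 + (\sum_(1 <= i < k.+1) w i * z (n - i)%N) / den n
     & forall s, s \in J -> z (n - s)%N <= K1 * den n]) ->
    forall n, (N < n)%N -> z n <= M.
Proof.
move=> w_ge0 a_gt0 K0_ge0 K1_ge0 J0 eta_gt0 hit.
(* [w i / a] bounds the factor [w i / den]; [w i] is what remains of that factor once its
   denominator is cancelled. *)
pose W : R := \sum_(1 <= i < k.+1) (w i + w i / a).
have term_ge0 i : (1 <= i < k.+1)%N -> 0 <= w i /\ 0 <= w i / a.
  by move=> Hi; have := w_ge0 i Hi => Hw; split=> //; rewrite divr_ge0 // ltW.
have W_ge0 : 0 <= W.
  rewrite /W big_nat_cond sumr_ge0 // => i /andP[/term_ge0[? ?] _].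
  by rewrite addr_ge0.
have leW i : (1 <= i < k.+1)%N -> w i <= W /\ w i / a <= W.
  move=> Hi; have [h1 h2] := term_ge0 i Hi.
  suff : w i + w i / a <= W by move=> h; split; lra.
  rewrite /W (bigD1_seq i) ?mem_index_iota ?iota_uniq //=.
  rewrite lerDl big_nat_cond sumr_ge0 // => j /andP[/term_ge0[? ?] _].
  by rewrite addr_ge0.
(* [l] is the chain of lags followed so far, latest first, which has led down to
   time [m]; [t] is the coefficient of [z m] in the expansion.  [V] bounds [t],
   also after one of its denominators, at time [m + sumn (take i l)], is
   cancelled. *)
suff claim r (V : R) : 0 <= V -> exists2 M, 0 <= M &
    forall z den : nat -> R,
    (forall n, (n0 < n)%N -> [/\ a <= den n,
       z n <= K0 + (\sum_(1 <= i < k.+1) w i * z (n - i)%N) / den n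
     & forall s, s \in J -> z (n - s)%N <= K1 * den n]) ->
    forall (l : seq nat) m (t : R), (size l + r = eta)%N ->
      {subset l <= pos_index k w} ->
      (forall d i, sumn (take i (drop d l)) \notin J) ->
      (n0 + k * r < m)%N -> 0 <= t <= V ->
      (forall i, (0 < sumn (take i l))%N -> t * den (m + sumn (take i l))%N <= V) ->
      t * z m <= M.
  have [M M0 HM] := claim eta 1 ler01.
  exists M, (n0 + k * eta)%N; split=> // z den H n Hn.
  by rewrite -[z n]mul1r; apply: (HM z den H [::]); rewrite //= ler01 lexx.
elim: r V => [|r IH] V V0.
  (* A chain of full length [eta], continued by repeating its last lag, is an admissible sequence;
     as [N2 <= eta], the block that hits [J] lies inside the chain, a contradiction. *)
  exists 0 => // z den _ l m t sl lI NH.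
  have /hit[N1 [N2 [_ /andP[_ leN2]]]] :
      forall m, (1 <= m)%N -> nth 0%N l (size l - m) \in pos_index k w.
    move=> j j1; apply/lI/mem_nth; rewrite ltn_subrL j1 /=.
    by rewrite -[size l]addn0 sl.
  by rewrite big_nat_nth_sumn ?(negPf (NH _ _)) // -[size l]addn0 sl.
have [M M0 HM] := IH (V * W) (mulr_ge0 V0 W_ge0).
(* Each lag contributes at most [M] if its chain continues and at most [K1 * (V * W)] if it is
   absorbed; the sum covers both cases. *)
exists (V * K0 + \sum_(1 <= i < k.+1) (M + K1 * (V * W))).
  by rewrite addr_ge0 ?mulr_ge0 ?sumr_ge0 // => i _; rewrite addr_ge0 ?mulr_ge0.
move=> z den H l m t sl lI NH Hm /andP[t0 tV] Ht.
have {}Hm : (n0 + k * r + k < m)%N by rewrite -addnA -mulnSr.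
have mn0 : (n0 < m)%N by move: Hm; clear; lia.
have mSn0 S : (n0 < m + S)%N by rewrite ltn_addr.
have [aden zm _] := H m mn0.
have den0 : 0 < den m by apply: lt_le_trans aden.
apply: (le_trans (ler_wpM2l t0 zm)).
rewrite mulrDr lerD ?ler_wpM2r // mulr_suml mulr_sumr ler_sum_nat // => c Hc.
have [wc0 _] := term_ge0 c Hc.
have [wcW wcaW] := leW c Hc.
have wdW : w c / den m <= W.
  by apply: le_trans wcaW; rewrite ler_wpM2l // lef_pV2.
have wd0 : 0 <= w c / den m by rewrite divr_ge0 // ltW.
pose t' := t * (w c / den m).
have -> : t * (w c * z (m - c)%N / den m) = t' * z (m - c)%N by rewrite /t'; ring.
have Ht'0 : 0 <= t' by rewrite mulr_ge0.
have [c_gt0 ck] := andP Hc; rewrite ltnS in ck.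
have cm : (c <= m)%N by move: Hm ck; clear; lia.
(* If the partial sum is 0, the denominator is [den m], which cancels against the new factor;
   otherwise the bound for [l] is multiplied by [w c / den m]. *)
have den' i : t' * den (m + sumn (take i l))%N <= V * W.
  have [|/Ht tden] := posnP (sumn (take i l)).
    move=> ->; rewrite addn0 /t' -mulrA divfK ?gt_eqF //.
    exact: ler_pM.
  have [aS _ _] := H _ (mSn0 (sumn (take i l))).
  by rewrite /t' mulrAC ler_pM // mulr_ge0 // ltW // (lt_le_trans a_gt0).
have KVW : 0 <= K1 * (V * W) by rewrite !mulr_ge0.
have [wc|] := ltrP 0 (w c); last first.
  move=> wcle; have wcE : w c = 0 by apply/eqP; rewrite eq_le wcle.
  by rewrite /t' wcE mul0r mulr0 mul0r addr_ge0.
(* Only blocks ending with the new lag [c] are left to test. Such a block starts at time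
   [m + sumn (take i l)] and leads down to [m - c]. *)
have [[i Hi]|NHc] := pselect (exists i, sumn (take i (c :: l)) \in J).
  case: i Hi => [|i] /= Hi; first by rewrite Hi in J0.
  have [_ _ /(_ _ Hi)] := H _ (mSn0 (sumn (take i l))).
  rewrite subnDr.
  move=> /(ler_wpM2l Ht'0) /le_trans; apply.
  by rewrite mulrCA -[leLHS]add0r lerD // ler_wpM2l.
apply: (@le_trans _ _ M); last by rewrite lerDl.
apply: (HM z den H (c :: l)).
- by rewrite -sl addSnnS.
- by move=> j; rewrite inE => /predU1P[->|/lI//]; rewrite inE wc andbT.
- move=> [|d] i; last exact: NH.
  by rewrite drop0; apply/negP => Hi; apply: NHc; exists i.
- by move: Hm ck; clear; lia.
- by rewrite Ht'0 /t' ler_pM.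
- move=> [|i] //= _; by rewrite addnA subnK.
Qed.

Lemma ler_sum_nat_term (R : realType) (k i : nat) (f : nat -> R) :
  (forall j, (1 <= j <= k)%N -> 0 <= f j) -> (1 <= i <= k)%N ->
  f i <= \sum_(1 <= j < k.+1) f j.
Proof.
move=> f_ge0 Hi; rewrite (bigD1_seq i) ?mem_index_iota ?iota_uniq //=.
by rewrite lerDl big_nat_cond sumr_ge0 // => j /andP[/f_ge0].
Qed.

Lemma sumr_nat_ge0 (R : realType) (k : nat) (f : nat -> R) :
  (forall j, (1 <= j <= k)%N -> 0 <= f j) -> 0 <= \sum_(1 <= j < k.+1) f j.
Proof.
by move=> f_ge0; rewrite big_nat_cond sumr_ge0 // => j /andP[/f_ge0].
Qed.

Lemma affine_lag_ge (R : realType) (k : nat) (a : R) (b c : nat -> R)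
    (x y : int -> R) (n : nat) :
  0 <= a -> nonneg_coefs k b -> nonneg_coefs k c ->
  (forall i, (1 <= i <= k)%N -> 0 <= x (n%:Z - i%:Z) /\ 0 <= y (n%:Z - i%:Z)) ->
  [/\ a <= affine_lag k a b c x y n,
      forall i, (1 <= i <= k)%N -> b i * x (n%:Z - i%:Z) <= affine_lag k a b c x y n
    & forall i, (1 <= i <= k)%N -> c i * y (n%:Z - i%:Z) <= affine_lag k a b c x y n].
Proof.
move=> a_ge0 b_ge0 c_ge0 xy_ge0.
have bx_ge0 i : (1 <= i <= k)%N -> 0 <= b i * x (n%:Z - i%:Z).
  by move=> Hi; have [? _] := xy_ge0 i Hi; rewrite mulr_ge0 ?b_ge0.
have cy_ge0 i : (1 <= i <= k)%N -> 0 <= c i * y (n%:Z - i%:Z).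
  by move=> Hi; have [_ ?] := xy_ge0 i Hi; rewrite mulr_ge0 ?c_ge0.
have Sb := sumr_nat_ge0 bx_ge0; have Sc := sumr_nat_ge0 cy_ge0.
rewrite /affine_lag; split=> [|i Hi|i Hi]; first by rewrite -addrA lerDl addr_ge0.
- by have := ler_sum_nat_term bx_ge0 Hi; lra.
- by have := ler_sum_nat_term cy_ge0 Hi; lra.
Qed.

Lemma solution_ge0 (R : realType) (k : nat) (alpha A p q : R)
    (beta gamma B C delta epsilon D E : nat -> R) (x y : int -> R) :
  0 <= alpha -> 0 <= p -> nonneg_coefs k beta -> nonneg_coefs k gamma ->
  nonneg_coefs k delta -> nonneg_coefs k epsilon ->
  is_solution k alpha beta gamma A B C p delta epsilon q D E x y ->
  forall m : int, 1 - k%:Z <= m -> 0 <= x m /\ 0 <= y m.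
Proof.
move=> alpha_ge0 p_ge0 beta_ge0 gamma_ge0 delta_ge0 epsilon_ge0 [init step].
(* Strong induction, with the initial conditions as the case [n = 0]. *)
suff H n (m : int) : 1 - k%:Z <= m <= n%:Z -> 0 <= x m /\ 0 <= y m.
  by move=> m Hm; apply: (H `|m|%N); rewrite Hm; lia.
elim: n m => [|n IH] m; first exact: init.
move=> /andP[Hm1 Hm2]; have [Hm|Hm] : m <= n%:Z \/ m = n.+1%:Z by lia.
  by apply: IH; rewrite Hm1.
have xy_ge0 i : (1 <= i <= k)%N ->
    0 <= x (n.+1%:Z - i%:Z) /\ 0 <= y (n.+1%:Z - i%:Z).
  by move=> Hi; apply: IH; lia.
have [denx deny xE yE] := step n.+1 isT.
have [numx _ _] := affine_lag_ge alpha_ge0 beta_ge0 gamma_ge0 xy_ge0.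
have [numy _ _] := affine_lag_ge p_ge0 delta_ge0 epsilon_ge0 xy_ge0.
rewrite Hm xE yE; split; apply: divr_ge0; rewrite ?(ltW denx) ?(ltW deny) //.
  exact: le_trans numx.
exact: le_trans numy.
Qed.

Theorem theorem15 (R : realType) (k : nat) (k_gt0 : (0 < k)%N)
    (alpha A p q : R) (beta gamma B C delta epsilon D E : nat -> R)
    (alpha_ge0 : 0 <= alpha) (A_ge0 : 0 <= A) (p_ge0 : 0 <= p) (q_ge0 : 0 <= q)
    (beta_ge0 : nonneg_coefs k beta) (gamma_ge0 : nonneg_coefs k gamma)
    (B_ge0 : nonneg_coefs k B) (C_ge0 : nonneg_coefs k C)
    (delta_ge0 : nonneg_coefs k delta) (epsilon_ge0 : nonneg_coefs k epsilon)
    (D_ge0 : nonneg_coefs k D) (E_ge0 : nonneg_coefs k E)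
    (y_le_x : exists M1 M2 : R, [/\ 0 < M1, 0 <= M2 &
       forall x y : int -> R,
         is_solution k alpha beta gamma A B C p delta epsilon q D E x y ->
         forall n : nat, (1 <= n)%N -> y n%:Z <= M1 * x n%:Z + M2])
    (A_gt0 : 0 < A) (q_gt0 : 0 < q)
    (delta_sub_D : {subset pos_index k delta <= pos_index k D})
    (hit_DE : exists eta1 : nat, (0 < eta1)%N /\
       block_sums_hit (pos_index k epsilon)
         [predU pos_index k D & pos_index k E] eta1)
    (hit_B : exists eta2 : nat, (0 < eta2)%N /\
       block_sums_hit (pos_index k beta) (pos_index k B) eta2) :
  exists (M : R) (N : nat), [/\ 0 < M, (1 <= N)%N &
    forall x y : int -> R,
      is_solution k alpha beta gamma A B C p delta epsilon q D E x y ->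
      forall n : nat, (N < n)%N -> x n%:Z <= M /\ y n%:Z <= M].
Proof.
have [M1 [M2 [M1_gt0 M2_ge0 y_le]]] := y_le_x.
have [eta1 [eta1_gt0 hit1]] := hit_DE.
have [eta2 [eta2_gt0 hit2]] := hit_B.
have term_ge0 (u v : nat -> R) : nonneg_coefs k u -> nonneg_coefs k v ->
    nonneg_coefs k (fun j => u j / v j).
  by move=> u0 v0 j Hj; rewrite divr_ge0 ?u0 ?v0.
have cst_ge0 (c : R) : 0 <= c -> nonneg_coefs k (fun=> c) by move=> c0 j _.
have dD_ge0 := term_ge0 _ _ delta_ge0 D_ge0.
have MD_ge0 := term_ge0 _ _ (cst_ge0 _ (ltW M1_gt0)) D_ge0.
have E1_ge0 := term_ge0 _ _ (cst_ge0 _ ler01) E_ge0.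
have B1_ge0 := term_ge0 _ _ (cst_ge0 _ ler01) B_ge0.
have lag_subz (n i : nat) : (i <= k)%N -> (k < n)%N ->
    n%:Z - i%:Z = (n - i)%N%:Z.
  by move=> ik kn; rewrite subzn // (leq_trans ik) // ltnW.
(* Sums stand in for maxima over the indices; where [D j] or [E j] is 0, the quotient is 0 by
   convention. *)
pose K0 := p / q + \sum_(1 <= j < k.+1) delta j / D j.
pose K1 := M2 / q + \sum_(1 <= j < k.+1) M1 / D j + \sum_(1 <= j < k.+1) 1 / E j.
have K0_ge0 : 0 <= K0 by rewrite addr_ge0 ?divr_ge0 ?sumr_nat_ge0.
have K1_ge0 : 0 <= K1 by rewrite !addr_ge0 ?divr_ge0 ?sumr_nat_ge0.
have J0 : 0%N \notin [predU pos_index k D & pos_index k E] by rewrite !inE.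
(* The starting time is [k]: beyond it all lagged indices are at least 1, so subtraction in [nat] is
   exact and [y_le] applies to them. *)
have [My [Ny [My_ge0 boundy]]] :=
  block_hit_bound k epsilon_ge0 q_gt0 K0_ge0 K1_ge0 J0 eta1_gt0 hit1.
have {}boundy x y : is_solution k alpha beta gamma A B C p delta epsilon q D E x y ->
    forall n, (Ny < n)%N -> y n%:Z <= My.
  move=> sol; have [_ step] := sol.
  have xy_ge0 := solution_ge0 alpha_ge0 p_ge0 beta_ge0 gamma_ge0
    delta_ge0 epsilon_ge0 sol.
  apply: (boundy (fun n => y n%:Z) (affine_lag k q D E x y)) => n kn.
  have lag_ge0 i : (1 <= i <= k)%N ->
      0 <= x (n%:Z - i%:Z) /\ 0 <= y (n%:Z - i%:Z).
    by move=> Hi; apply: xy_ge0; move: Hi kn; clear; lia.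
  have n_gt0 : (0 < n)%N by apply: leq_trans kn.
  have [_ den_gt0 _ ->] := step n n_gt0.
  have [qden Dden Eden] := affine_lag_ge q_ge0 D_ge0 E_ge0 lag_ge0.
  set den := affine_lag k q D E x y n in den_gt0 qden Dden Eden *.
  split=> //.
    rewrite ler_pdivrMr // mulrDl divfK ?gt_eqF // /affine_lag lerD //; last first.
      by apply: ler_sum_nat => i /andP[_ ik]; rewrite lag_subz.
    rewrite /K0 mulrDl lerD //.
      by rewrite -[leLHS](divfK (lt0r_neq0 q_gt0)) ler_wpM2l ?divr_ge0.
    rewrite mulr_suml; apply: ler_sum_nat => i Hi.
    have [di|di] := ltrP 0 (delta i); last first.
      have -> : delta i = 0 by apply/eqP; rewrite eq_le di delta_ge0.
      by rewrite !mul0r.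
    have /andP[_ Di] : i \in pos_index k D.
      by apply: delta_sub_D; rewrite inE di andbT.
    rewrite -mulrA ler_wpM2l ?(ltW di) // mulrC ler_pdivlMr // mulrC.
    exact: Dden.
  move=> s sJ; have Hs : (1 <= s <= k)%N by move: sJ; rewrite !inE => /orP[] /andP[].
  have sk : (s <= k)%N by case/andP: Hs.
  rewrite -lag_subz // /K1 !mulrDl.
  have SD := sumr_nat_ge0 MD_ge0; have SE := sumr_nat_ge0 E1_ge0.
  have qM : M2 <= M2 / q * den.
    by rewrite -[leLHS](divfK (lt0r_neq0 q_gt0)) ler_wpM2l ?divr_ge0.
  case/orP: sJ => /andP[_ spos].
    have yx : y (n%:Z - s%:Z) <= M1 * x (n%:Z - s%:Z) + M2.
      by rewrite lag_subz //; apply: (y_le _ _ sol); rewrite subn_gt0 (leq_ltn_trans sk).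
    have xden : M1 * x (n%:Z - s%:Z) <= M1 / D s * den.
      rewrite -mulrA ler_wpM2l ?(ltW M1_gt0) // mulrC ler_pdivlMr // mulrC.
      exact: Dden.
    have /(ler_wpM2r (ltW den_gt0)) Ds := ler_sum_nat_term MD_ge0 Hs.
    move: (mulr_ge0 SE (ltW den_gt0)) yx xden qM Ds; clear => /=; lra.
  have yden : y (n%:Z - s%:Z) <= 1 / E s * den.
    by rewrite div1r mulrC ler_pdivlMr // mulrC; apply: Eden.
  have /(ler_wpM2r (ltW den_gt0)) Es := ler_sum_nat_term E1_ge0 Hs.
  have qM0 := le_trans M2_ge0 qM.
  move: (mulr_ge0 SD (ltW den_gt0)) yden qM0 Es; clear => /=; lra.
pose L0 := alpha / A + (\sum_(1 <= j < k.+1) gamma j * My) / A.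
have gM_ge0 : 0 <= \sum_(1 <= j < k.+1) gamma j * My.
  by apply: sumr_nat_ge0 => j Hj; rewrite mulr_ge0 ?gamma_ge0.
have L0_ge0 : 0 <= L0 by rewrite addr_ge0 ?divr_ge0.
have {}J0 : 0%N \notin pos_index k B by rewrite !inE.
(* After time [Ny + k] every lagged [y] is already at most [My], so the [gamma] terms are part of
   the constant [L0]. *)
have [Mx [Nx [Mx_ge0 boundx]]] := block_hit_bound (Ny + k) beta_ge0 A_gt0 L0_ge0
  (sumr_nat_ge0 B1_ge0) J0 eta2_gt0 hit2.
(* The added units make the bound strictly positive and the threshold at least 1. *)
exists (Mx + My + 1), (Nx + Ny).+1; split=> [|//|x y sol n Hn].
  by rewrite ltr_wpDl ?addr_ge0.
have [Nxn Nyn] : (Nx < n)%N /\ (Ny < n)%N by move: Hn; clear; lia.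
suff [xM yM] : x n%:Z <= Mx /\ y n%:Z <= My by move: xM yM Mx_ge0 My_ge0; clear; lra.
split; last exact: (boundy x y).
have [_ step] := sol.
have xy_ge0 := solution_ge0 alpha_ge0 p_ge0 beta_ge0 gamma_ge0
  delta_ge0 epsilon_ge0 sol.
apply: (boundx (fun n => x n%:Z) (affine_lag k A B C x y)) Nxn => {Hn Nyn}n Hn.
have lag_ge0 i : (1 <= i <= k)%N ->
    0 <= x (n%:Z - i%:Z) /\ 0 <= y (n%:Z - i%:Z).
  by move=> Hi; apply: xy_ge0; move: Hi Hn; clear; lia.
have [n_gt0 kn] : (0 < n)%N /\ (k < n)%N by move: Hn; clear; lia.
have [den_gt0 _ -> _] := step n n_gt0.
have [Aden Bden _] := affine_lag_ge A_ge0 B_ge0 C_ge0 lag_ge0.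
set den := affine_lag k A B C x y n in den_gt0 Aden Bden *.
split=> //.
  have AM c : 0 <= c -> c <= c / A * den.
    by move=> c0; rewrite -[leLHS](divfK (lt0r_neq0 A_gt0)) ler_wpM2l ?divr_ge0.
  rewrite ler_pdivrMr // mulrDl divfK ?gt_eqF // /affine_lag addrAC.
  apply: lerD; last first.
    by apply: ler_sum_nat => i /andP[_ ik]; rewrite lag_subz.
  rewrite /L0 mulrDl lerD ?AM //.
  apply: le_trans (AM _ gM_ge0); apply: ler_sum_nat => i Hi.
  have /andP[_ ik] := Hi; rewrite ltnS in ik.
  rewrite ler_wpM2l ?gamma_ge0 // lag_subz //.
  by apply: (boundy x y) => //; move: Hn ik; clear; lia.
move=> s sB; have /andP[Hs spos] := sB.
have sk : (s <= k)%N by case/andP: Hs.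
rewrite -lag_subz //.
have xden : x (n%:Z - s%:Z) <= 1 / B s * den.
  by rewrite div1r mulrC ler_pdivlMr // mulrC; apply: Bden.
apply: le_trans xden _; apply: ler_wpM2r (ltW den_gt0) _ _ _.
exact: ler_sum_nat_term B1_ge0 Hs.
Qed.
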